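(* Let $d\ge4$, let $\mathcal A\in\mathbb R^{n_1\times\cdots\times n_d}$, let $R\le n_d$, and suppose the singular values $\lambda_1\ge\lambda_2\ge\cdots$ of the mode-$d$ unfolding $A_{(d)}\in\mathbb R^{n_d\times\prod_{l<d}n_l}$ satisfy $\lambda_R>0$. Let $(\mathbf u_{j,i})_{1\le j\le d,\,1\le i\le R}$ be generated by the initialization procedure with $t=1$ (described in the context). Then $$\sum_{i=1}^R\Big\langle\mathcal A,\bigotimes_{j=1}^d\mathbf u_{j,i}\Big\rangle^2\;\ge\;\frac{\sum_{i=1}^R\lambda_i^2}{\xi(d-1)^2\,n_{d-2}\,n_{d-1}}\;\ge\;\frac{G_{\max}}{\xi(d-1)^2\,n_{d-2}\,n_{d-1}},$$ where $G_{\max}$ is the maximum of $\sum_{i=1}^R\langle\mathcal A,\bigotimes_{j=1}^d\mathbf x_{j,i}\rangle^2$ over all $\mathbf x_{j,i}\in\mathbb R^{n_j}$ with $\|\mathbf x_{j,i}\|=1$ for $1\le j\le d-1$, $1\le i\le R$, and $\mathbf x_{d,1},\dots,\mathbf x_{d,R}$ orthonormal.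
   Context: Definition of $\xi$: for even $m$, $\xi(m)=\sqrt{\prod_{j=1}^{m-1}n_j\cdot\prod_{j=1}^{m/2-2}n_{2j+1}\cdot n_2^{-1}}$; for odd $m$, $\xi(m)=\sqrt{\prod_{j=2}^{m-1}n_j\cdot\prod_{j=1}^{(m+1)/2-2}n_{2j}}$ ($m\ge 3$; empty products equal $1$). Unfolding: $A_{(d)}$ is the matrix whose rows are indexed by the $d$-th index of $\mathcal A$ and whose columns are indexed by the remaining indices. $\mathcal A\times_d\mathbf u^\top$ denotes contraction of the $d$-th mode of $\mathcal A$ with the vector $\mathbf u$. Initialization procedure ($t=1$): (1) let $\mathbf u_{d,1},\dots,\mathbf u_{d,R}$ be (orthonormal) left singular vectors of $A_{(d)}$ associated with $\lambda_1,\dots,\lambda_R$. (2) For each $i=1,\dots,R$ set $(\mathbf u_{1,i},\dots,\mathbf u_{d-1,i})=\mathrm{rank1approx}(\mathcal A\times_d\mathbf u_{d,i}^\top)$, where $\mathcal A\times_d\mathbf u_{d,i}^\top\in\mathbb R^{n_1\times\cdots\times n_{d-1}}$. Procedure $(\mathbf x_1,\dots,\mathbf x_m)=\mathrm{rank1approx}(\mathcal B)$ for $\mathcal B\in\mathbb R^{n_1\times\cdots\times n_m}$, defined recursively: if $m=1$, $\mathbf x_1=\mathcal B/\|\mathcal B\|_F$. If $m=2$, $(\mathbf x_1,\mathbf x_2)$ is a normalized leading singular vector pair of the matrix $\mathcal B$ (unit vectors with $\mathbf x_1^\top\mathcal B\mathbf x_2=\|\mathcal B\|_2$). If $m\ge3$: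 reshape $\mathcal B$ as a matrix $B\in\mathbb R^{\prod_{j=1}^{m-2}n_j\times n_{m-1}n_m}$ (rows indexed by the first $m-2$ indices, columns by the last two); let $(\mathbf x_{1,\dots,m-2},\mathbf x_{m-1,m})$ be a normalized leading singular vector pair of $B$; reshape $\mathbf x_{m-1,m}$ into a matrix $X_{m-1,m}\in\mathbb R^{n_{m-1}\times n_m}$ and put $(\mathbf x_{m-1},\mathbf x_m)=\mathrm{rank1approx}(X_{m-1,m})$; then put $(\mathbf x_1,\dots,\mathbf x_{m-2})=\mathrm{rank1approx}(\mathcal B\times_{m-1}\mathbf x_{m-1}^\top\times_m\mathbf x_m^\top)$, where $\mathcal B\times_{m-1}\mathbf x_{m-1}^\top\times_m\mathbf x_m^\top\in\mathbb R^{n_1\times\cdots\times n_{m-2}}$ is the contraction in the last two modes. *)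

(* Defs.v *)
From HB Require Import structures.
From mathcomp Require Import all_boot all_order all_algebra.
From mathcomp Require Import classical_sets reals.

Set Implicit Arguments.
Unset Strict Implicit.
Unset Printing Implicit Defensive.

Import Order.TTheory GRing.Theory Num.Theory.
Local Open Scope ring_scope.

(* Modes are numbered from 1: the dimension of mode j is n j, and a tensor of  *)
(* order m only involves n 1, ..., n m.  Multi-indices are left-nested pairs,  *)
(* (((tt, i_1), i_2), ..., i_m).                                               *)
Fixpoint idx (n : nat -> nat) (m : nat) : finType :=
  if m is k.+1 then (idx n k * 'I_(n k.+1))%type else unit.

Definition tensor (R : realType) (n : nat -> nat) (m : nat) : Type :=
  idx n m -> R.

Section Euclidean.
Variable R : realType.

Definition dot p (u v : 'cV[R]_p) : R := (u^T *m v) 0 0.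

(* The library norm on matrices is the max norm, hence this definition.        *)
Definition norm2 p (u : 'cV[R]_p) : R := Num.sqrt (dot u u).

Definition orthonormal r p (v : 'I_r -> 'cV[R]_p) : Prop :=
  forall i k, dot (v i) (v k) = (i == k)%:R.

Definition spectral_norm p q (M : 'M[R]_(p, q)) : R :=
  sup [set norm2 (M *m v) | v in [set v : 'cV[R]_q | norm2 v = 1]]%classic.

Definition leading_pair p q (M : 'M[R]_(p, q)) (x : 'cV_p) (y : 'cV_q) : Prop :=
  [/\ norm2 x = 1, norm2 y = 1 & dot x (M *m y) = spectral_norm M].

(* s k is the (k+1)-st singular value: the diagonal of Sigma in a full         *)
(* decomposition M = U Sigma V^T, extended by 0 beyond min(p, q).              *)
Definition singular_values p q (M : 'M[R]_(p, q)) (s : nat -> R) : Prop :=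
  [/\ forall k, 0 <= s k,
      forall k, s k.+1 <= s k,
      forall k, (minn p q <= k)%N -> s k = 0
    & exists (U : 'M[R]_p) (V : 'M[R]_q),
        [/\ U^T *m U = 1%:M, V^T *m V = 1%:M
          & M = U *m (\matrix_(i, j) (s i *+ (i == j :> nat))) *m V^T]].

Definition left_singular_vector p q (M : 'M[R]_(p, q)) (s : R) (u : 'cV_p) :
    Prop :=
  norm2 u = 1 /\
  exists v : 'cV_q, [/\ norm2 v = 1, M *m v = s *: u & M^T *m u = s *: v].

Definition is_maximum (S : set R) (g : R) : Prop := S g /\ ubound S g.

End Euclidean.

Section Tensors.
Variables (R : realType) (n : nat -> nat).

Definition inner m (A B : tensor R n m) : R := \sum_i A i * B i.

Definition fnorm m (A : tensor R n m) : R := Num.sqrt (inner A A).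

(* x_1 (x) ... (x) x_m; the members of the family x outside 1..m are not used. *)
Fixpoint outer m (x : forall j, 'cV[R]_(n j)) : tensor R n m :=
  if m is k.+1 return tensor R n m
  then fun i => outer x i.1 * x k.+1 i.2 0 else fun=> 1.

(* Contraction of the last mode, d, with v.  The value for d = 0 is junk.      *)
Definition contract_last d : tensor R n d -> 'cV[R]_(n d) -> tensor R n d.-1 :=
  if d is k.+1 return tensor R n d -> 'cV[R]_(n d) -> tensor R n d.-1
  then fun A v i => \sum_a A (i, a) * v a 0 else fun _ _ _ => 0.

(* A_(d), with its columns ordered by the enumeration of idx n d.-1.           *)
(* The value for d = 0 is junk.                                                *)
Definition unfold_last d : tensor R n d -> 'M[R]_(n d, #|idx n d.-1|) :=
  if d is k.+1 return tensor R n d -> 'M[R]_(n d, #|idx n d.-1|)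
  then fun A => \matrix_(a, j) A (enum_val j, a) else fun=> 0.

(* Rows are indexed by the first m modes, columns by the last two; the columns *)
(* are ordered by mxvec, so that vec_mx reshapes a row into a matrix.          *)
Definition unfold_last2 m (B : tensor R n m.+2) :
    'M[R]_(#|idx n m|, n m.+1 * n m.+2) :=
  \matrix_(i < #|idx n m|) mxvec (\matrix_(a, b) B ((enum_val i, a), b)).

(* rank1approx x B: (x_1, ..., x_m) is a possible output of the procedure on B *)
(* (leading singular vector pairs are not unique, hence a relation).  In the   *)
(* last case, the order-two call on the reshaped z is written out.             *)
Inductive rank1approx (x : forall j, 'cV[R]_(n j)) :
    forall m, tensor R n m -> Prop :=
| Rank1approx1 (B : tensor R n 1) :
    x 1%N = \col_a (B (tt, a) / fnorm B) -> rank1approx x B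
| Rank1approx2 (B : tensor R n 2) :
    leading_pair (\matrix_(a, b) B ((tt, a), b)) (x 1%N) (x 2%N) ->
    rank1approx x B
| Rank1approx3 m (B : tensor R n m.+3)
    (y : 'cV[R]_#|idx n m.+1|) (z : 'cV[R]_(n m.+2 * n m.+3)) :
    leading_pair (unfold_last2 B) y z ->
    leading_pair (vec_mx z^T) (x m.+2) (x m.+3) ->
    rank1approx x (contract_last (contract_last B (x m.+3)) (x m.+2)) ->
    rank1approx x B.

(* u j i is the vector u_{j,i}; the terms i are numbered from 0, so lambda i   *)
(* is the singular value attached to u d i.                                    *)
Definition initialization d r (A : tensor R n d) (lambda : nat -> R)
    (u : forall j, 'I_r -> 'cV[R]_(n j)) : Prop :=
  [/\ orthonormal (u d),
      forall i : 'I_r, left_singular_vector (unfold_last A) (lambda i) (u d i)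
    & forall i : 'I_r, rank1approx (fun j => u j i) (contract_last A (u d i))].

Definition objective d r (A : tensor R n d)
    (x : forall j, 'I_r -> 'cV[R]_(n j)) : R :=
  \sum_(i < r) inner A (outer (fun j => x j i)) ^+ 2.

Definition feasible d r (x : forall j, 'I_r -> 'cV[R]_(n j)) : Prop :=
  (forall j i, (1 <= j < d)%N -> norm2 (x j i) = 1) /\ orthonormal (x d).

Definition objective_values d r (A : tensor R n d) : set R :=
  [set objective A x | x in @feasible d r]%classic.

Definition xi (m : nat) : R :=
  Num.sqrt
    (if odd m then
       \prod_(2 <= j < m) (n j)%:R
       * \prod_(1 <= j < (m.+1./2 - 2).+1) (n j.*2)%:R
     else
       \prod_(1 <= j < m) (n j)%:R
       * \prod_(1 <= j < (m./2 - 2).+1) (n j.*2.+1)%:R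
       * (n 2)%:R^-1).

End Tensors.

(* Main.v *)
(* A leading pair (y, z) of the matrix B satisfies B^T y = |B|_2 z, and |B|_2^2
   is at least |B|_F^2 divided by the number of rows, or of columns.  One
   reshaping step of rank1approx therefore keeps at least the fraction
   1 / (n_(m-1) n_m) of the squared norm in z and 1 / n_(m-1) in the rank-one
   approximation of z; recursion on the remaining m - 2 modes multiplies these
   losses up to xi(m)^2 n_(m-1) n_m.  The upper bound on G_max is Ky Fan's
   inequality for A_(d), since a tensor product of unit vectors is a unit
   vector. *)
Require Import Defs.
From mathcomp Require Import all_boot all_order all_algebra.
From mathcomp Require Import ring lra.
From mathcomp Require Import boolp classical_sets reals.
From mathcomp Require Import topology normedtype derive.

Set Implicit Arguments.
Unset Strict Implicit.
Unset Printing Implicit Defensive.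

Import Order.TTheory GRing.Theory Num.Theory.
Import numFieldNormedType.Exports.
Local Open Scope ring_scope.

(** * Cauchy-Schwarz for finite sums *)

Lemma cauchy_schwarz_sum (R : realFieldType) (I : finType) (f g : I -> R) :
  (\sum_i f i * g i) ^+ 2 <= (\sum_i f i ^+ 2) * (\sum_i g i ^+ 2).
Proof.
(* Lagrange's identity; summing over ordered pairs counts each square twice. *)
have lagrange : \sum_i \sum_j (f i * g j - f j * g i) ^+ 2 =
    ((\sum_i f i ^+ 2) * (\sum_i g i ^+ 2) - (\sum_i f i * g i) ^+ 2) *+ 2.
  transitivity (\sum_i \sum_j (f i ^+ 2 * g j ^+ 2)
      + \sum_i \sum_j (f j ^+ 2 * g i ^+ 2)
      - (\sum_i \sum_j (f i * g i) * (f j * g j)) *+ 2).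
    rewrite -sumrMnl -big_split -sumrB /=; apply: eq_bigr => i _.
    rewrite -sumrMnl -big_split -sumrB /=; apply: eq_bigr => j _; ring.
  rewrite [X in _ + X - _]exchange_big /= expr2 !big_distrlr /=; ring.
suff: 0 <= \sum_i \sum_j (f i * g j - f j * g i) ^+ 2.
  by rewrite lagrange pmulrn_lge0 // subr_ge0.
by apply: sumr_ge0 => i _; apply: sumr_ge0 => j _; apply: sqr_ge0.
Qed.

(** * Euclidean geometry of column vectors *)

Section Dot.
Variable R : realType.
Implicit Types p q : nat.

Lemma dotE p (u v : 'cV[R]_p) : dot u v = \sum_k u k 0 * v k 0.
Proof. by rewrite /dot mxE; apply: eq_bigr => k _; rewrite mxE. Qed.

Lemma dotvv p (u : 'cV[R]_p) : dot u u = \sum_k u k 0 ^+ 2.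
Proof. by rewrite dotE; apply: eq_bigr => k _; rewrite expr2. Qed.

Lemma dotC p (u v : 'cV[R]_p) : dot u v = dot v u.
Proof. by rewrite !dotE; apply: eq_bigr => k _; rewrite mulrC. Qed.

Lemma dotvv_ge0 p (u : 'cV[R]_p) : 0 <= dot u u.
Proof. by rewrite dotvv sumr_ge0 // => k _; apply: sqr_ge0. Qed.

Lemma dotvv_eq0 p (u : 'cV[R]_p) : dot u u = 0 -> u = 0.
Proof.
rewrite dotvv => /eqP; rewrite psumr_eq0 => [/allP u0|k _]; last exact: sqr_ge0.
apply/matrixP => k j; rewrite ord1 mxE.
by apply/eqP; rewrite -sqrf_eq0; apply: u0; rewrite mem_index_enum.
Qed.

Lemma dot_mulmxl p q (M : 'M[R]_(p, q)) v u : dot (M *m v) u = dot v (M^T *m u).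
Proof. by rewrite /dot trmx_mul mulmxA. Qed.

Lemma dotBvv p (u v : 'cV[R]_p) :
  dot (u - v) (u - v) = dot u u - dot u v *+ 2 + dot v v.
Proof.
rewrite !dotE -sumrMnl -sumrB -big_split /=.
by apply: eq_bigr => k _; rewrite !mxE; ring.
Qed.

Lemma dotvZ p a (u v : 'cV[R]_p) : dot u (a *: v) = a * dot u v.
Proof. by rewrite /dot -scalemxAr mxE. Qed.

Lemma dotZv p a (u v : 'cV[R]_p) : dot (a *: u) v = a * dot u v.
Proof. by rewrite dotC dotvZ dotC. Qed.

Lemma dot_delta p k (v : 'cV[R]_p) : dot (delta_mx k 0) v = v k 0.
Proof.
rewrite dotE (bigD1 k) //= mxE !eqxx mul1r big1 ?addr0 // => i /negPf ik.
by rewrite mxE ik mul0r.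
Qed.

Lemma norm2_ge0 p (u : 'cV[R]_p) : 0 <= norm2 u.
Proof. exact: sqrtr_ge0. Qed.

Lemma sqr_norm2 p (u : 'cV[R]_p) : norm2 u ^+ 2 = dot u u.
Proof. by rewrite sqr_sqrtr // dotvv_ge0. Qed.

Lemma norm2_eq1 p (u : 'cV[R]_p) : norm2 u = 1 <-> dot u u = 1.
Proof.
split=> [u1|]; first by rewrite -sqr_norm2 u1 expr1n.
by rewrite /norm2 => ->; rewrite sqrtr1.
Qed.

Lemma norm2_delta p (k : 'I_p) : norm2 (delta_mx k 0 : 'cV[R]_p) = 1.
Proof. by apply/norm2_eq1; rewrite dot_delta mxE !eqxx. Qed.

Lemma dot_sqr_le p (u v : 'cV[R]_p) : dot u v ^+ 2 <= dot u u * dot v v.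
Proof. by rewrite !dotvv dotE cauchy_schwarz_sum. Qed.

Lemma dot_normalize p (v : 'cV[R]_p) :
  v != 0 -> exists2 w, norm2 w = 1 & v = norm2 v *: w.
Proof.
move=> v0; have nv0 : norm2 v != 0.
  apply: contra_neq v0 => nv0; apply: dotvv_eq0.
  by rewrite -sqr_norm2 nv0 expr0n.
exists ((norm2 v)^-1 *: v); last by rewrite scalerA divff // scale1r.
apply/norm2_eq1; rewrite dotvZ dotZv -sqr_norm2; field; exact: nv0.
Qed.

(** The squared Frobenius norm. *)
Definition mxnorm2 p q (M : 'M[R]_(p, q)) : R := \sum_i \sum_j M i j ^+ 2.

Lemma dot_mulmx_le_mxnorm2 p q (M : 'M[R]_(p, q)) v :
  dot (M *m v) (M *m v) <= mxnorm2 M * dot v v.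
Proof.
rewrite !dotvv mulr_suml; apply: ler_sum => i _; rewrite mxE.
exact: cauchy_schwarz_sum.
Qed.

(** * Spectral norm against Frobenius norm; leading pairs *)

Section SpectralNorm.
Variables (p q : nat) (M : 'M[R]_(p, q)).

(** The supremum is a genuine upper bound because the Frobenius norm bounds the set. *)
Lemma spectral_norm_ub (v : 'cV_q) :
  norm2 v = 1 -> norm2 (M *m v) <= spectral_norm M.
Proof.
move=> v1; apply: ub_le_sup; last by exists v.
exists (Num.sqrt (mxnorm2 M)) => _ [w /norm2_eq1 w1 <-].
by apply: ler_wsqrtr; rewrite (le_trans (dot_mulmx_le_mxnorm2 _ _)) // w1 mulr1.
Qed.

Lemma spectral_norm_sqr_ub (v : 'cV_q) :
  dot (M *m v) (M *m v) <= spectral_norm M ^+ 2 * dot v v.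
Proof.
have [->|v0] := eqVneq v 0.
  by rewrite mulmx0 !dotvv !big1 ?mulr0 // => k _; rewrite mxE expr0n.
have [w w1 ->] := dot_normalize v0.
rewrite -scalemxAr !(dotvZ, dotZv) -!sqr_norm2 w1 expr1n.
have le_w : norm2 (M *m w) ^+ 2 <= spectral_norm M ^+ 2.
  by rewrite lerXn2r ?nnegrE ?spectral_norm_ub ?norm2_ge0 //
    (le_trans (norm2_ge0 _) (spectral_norm_ub w1)).
by have := ler_wpM2l (sqr_ge0 (norm2 v)) le_w; lra.
Qed.

(** Each column is the image of a basis vector. *)
Lemma mxnorm2_le_cols : mxnorm2 M <= q%:R * spectral_norm M ^+ 2.
Proof.
rewrite /mxnorm2 exchange_big /=.
apply: (@le_trans _ _ (\sum_(j < q) spectral_norm M ^+ 2)); last first.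
  by rewrite sumr_const card_ord mulr_natl.
apply: ler_sum => j _.
have := spectral_norm_sqr_ub (delta_mx j 0).
rewrite dot_delta mxE !eqxx mulr1 dotvv; apply: le_trans.
by apply: ler_sum => i _; rewrite -colE mxE.
Qed.

(** With [w = M^T u], Cauchy-Schwarz on [|w|^2 = <M w, u>] gives [|w|^4 <= |M|^2 |w|^2 |u|^2];
    divide by [|w|^2]. *)
Lemma spectral_norm_sqr_ub_tr (u : 'cV_p) :
  dot (M^T *m u) (M^T *m u) <= spectral_norm M ^+ 2 * dot u u.
Proof.
set w := M^T *m u; set t := dot w w.
have le_t : t ^+ 2 <= spectral_norm M ^+ 2 * t * dot u u.
  have {1}-> : t = dot (M *m w) u by rewrite dot_mulmxl.
  apply: le_trans (dot_sqr_le _ _) _; rewrite ler_wpM2r ?dotvv_ge0 //.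
  exact: spectral_norm_sqr_ub.
have [t0|t0] := leP t 0.
  by apply: le_trans t0 _; rewrite mulr_ge0 ?sqr_ge0 ?dotvv_ge0.
by rewrite -(ler_pM2r t0) -expr2 mulrAC.
Qed.

Lemma mxnorm2_le_rows : mxnorm2 M <= p%:R * spectral_norm M ^+ 2.
Proof.
apply: (@le_trans _ _ (\sum_(i < p) spectral_norm M ^+ 2)); last first.
  by rewrite sumr_const card_ord mulr_natl.
apply: ler_sum => i _.
have := spectral_norm_sqr_ub_tr (delta_mx i 0).
rewrite dot_delta mxE !eqxx mulr1 dotvv; apply: le_trans.
by apply: ler_sum => j _; rewrite -colE !mxE.
Qed.

(** Equality case: with [s] the spectral norm, [|M^T x - s y|^2 = |M^T x|^2 - 2 s^2 + s^2 <= 0]. *)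
Lemma leading_pair_trmul x y :
  leading_pair M x y -> M^T *m x = spectral_norm M *: y.
Proof.
case=> /norm2_eq1 x1 /norm2_eq1 y1 xMy.
have le_Mx := spectral_norm_sqr_ub_tr x.
have xMy' : dot (M^T *m x) y = spectral_norm M by rewrite dot_mulmxl trmxK.
apply/eqP; rewrite -subr_eq0; apply/eqP; apply: dotvv_eq0; apply/le_anti.
rewrite dotvv_ge0 andbT dotBvv !(dotvZ, dotZv) xMy' y1.
by move: le_Mx; rewrite x1; lra.
Qed.

End SpectralNorm.
End Dot.

(** * Reshaping vectors into matrices *)

Section Reshape.
Variable R : realType.

Lemma sum_mxvec_sqr p q (X : 'M[R]_(p, q)) :
  \sum_j mxvec X 0 j ^+ 2 = mxnorm2 X.
Proof.
rewrite (reindex _ (curry_mxvec_bij _ _)) /= /mxnorm2 pair_bigA /=.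
by apply: eq_bigr => -[a b] _; rewrite mxvecE.
Qed.

Lemma mxnorm2_vec_mx p q (z : 'cV[R]_(p * q)) : mxnorm2 (vec_mx z^T) = dot z z.
Proof.
by rewrite -sum_mxvec_sqr vec_mxK dotvv; apply: eq_bigr => j _; rewrite mxE.
Qed.

Lemma mxvec_outer_dot p q (X : 'M[R]_(p, q)) w v :
  mxvec X *m (mxvec (w *m v^T))^T = w^T *m X *m v.
Proof.
rewrite -[v in RHS]trmxK -mxvec_dotmul trmxK.
(* [mxvec_dotmul] puts the outer product on the left; the trace shows that a 1x1 matrix equals its
   transpose. *)
by apply/matrixP => i j; rewrite !ord1 -[RHS]trace_mx11 -mxtrace_tr trmx_mul
  trmxK trace_mx11.
Qed.

Lemma dot_mxvec_outer p q (z : 'cV[R]_(p * q)) w v :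
  dot z (mxvec (w *m v^T))^T = dot w (vec_mx z^T *m v).
Proof. by rewrite /dot -[z^T in LHS]vec_mxK mxvec_outer_dot mulmxA. Qed.

End Reshape.

(** * Tensor contractions and the norm retained by [rank1approx] *)

Section Tensor.
Variables (R : realType) (n : nat -> nat).

Lemma sum_idx0 (F : idx n 0 -> R) : \sum_i F i = F tt.
Proof. by rewrite (bigD1 tt) //= big1 ?addr0 // => -[]. Qed.

Lemma sum_idxS k (F : idx n k.+1 -> R) :
  \sum_i F i = \sum_(i : idx n k) \sum_(a < n k.+1) F (i, a).
Proof. by rewrite pair_bigA; apply: eq_bigr => -[i a] _. Qed.

Lemma sum_idx_enum m (F : idx n m -> R) :
  \sum_i F i = \sum_(k < #|idx n m|) F (enum_val k).
Proof. exact: (reindex _ (onW_bij _ (@enum_val_bij _))). Qed.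

Lemma inner_ge0 m (B : tensor R n m) : 0 <= inner B B.
Proof. by apply: sumr_ge0 => i _; rewrite -expr2 sqr_ge0. Qed.

Lemma inner_sqr_le m (B C : tensor R n m) :
  inner B C ^+ 2 <= inner B B * inner C C.
Proof. exact: cauchy_schwarz_sum. Qed.

Lemma sqr_fnorm m (B : tensor R n m) : fnorm B ^+ 2 = inner B B.
Proof. by rewrite sqr_sqrtr ?inner_ge0. Qed.

(** Peels off the last mode, matching the recursion of [rank1approx]. *)
Lemma inner_outer_contract k (B : tensor R n k.+1) x :
  inner B (outer x) = inner (contract_last B (x k.+1)) (outer x).
Proof.
rewrite /inner sum_idxS; apply: eq_bigr => i _ /=; rewrite mulr_suml.
by apply: eq_bigr => a _; rewrite mulrA mulrAC.
Qed.

Lemma eq_outer m (x y : forall j, 'cV[R]_(n j)) :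
  (forall j, (1 <= j <= m)%N -> x j = y j) -> outer x =1 outer (m := m) y.
Proof.
elim: m => [//|m IHm] eqxy i /=.
rewrite eqxy ?ltnSn // (IHm _ i.1) // => j /andP[j1 jm].
by rewrite eqxy // j1 (leq_trans jm).
Qed.

Lemma inner_outer_unit m (x : forall j, 'cV[R]_(n j)) :
  (forall j, (1 <= j <= m)%N -> norm2 (x j) = 1) ->
  inner (outer (m := m) x) (outer x) = 1.
Proof.
elim: m => [|m IHm] x1.
  by rewrite /inner sum_idx0 mulr1.
rewrite /inner sum_idxS -[RHS]IHm => [|j /andP[j1 jm]]; last first.
  by rewrite x1 // j1 (leq_trans jm).
apply: eq_bigr => i _ /=.
have /norm2_eq1 := x1 m.+1 (leqnn _); rewrite dotvv => xm1.
rewrite -[RHS]mulr1 -{}[in RHS]xm1 mulr_sumr.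
by apply: eq_bigr => a _; ring.
Qed.

Lemma mxnorm2_unfold_last2 m (B : tensor R n m.+2) :
  mxnorm2 (unfold_last2 B) = inner B B.
Proof.
rewrite /inner !sum_idxS /mxnorm2.
rewrite [RHS]sum_idx_enum.
apply: eq_bigr => k _.
rewrite (eq_bigr (fun j => mxvec (\matrix_(a, b) B (enum_val k, a, b)) 0 j ^+ 2)).
  rewrite sum_mxvec_sqr; apply: eq_bigr => a _.
  by apply: eq_bigr => b _; rewrite mxE expr2.
by move=> j _; rewrite mxE.
Qed.

(** Links the matrix whose leading pair is taken to the tensor passed to the recursive call. *)
Lemma unfold_last2_mul m (B : tensor R n m.+2) w v k :
  (unfold_last2 B *m (mxvec (w *m v^T))^T) k 0
  = contract_last (contract_last B v) w (enum_val k).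
Proof.
have -> : (unfold_last2 B *m (mxvec (w *m v^T))^T) k 0 =
    (mxvec (\matrix_(a, b) B (enum_val k, a, b)) *m (mxvec (w *m v^T))^T) 0 0.
  by rewrite !mxE; apply: eq_bigr => j _; rewrite mxE.
rewrite mxvec_outer_dot -mulmxA mxE; apply: eq_bigr => a _.
by rewrite !mxE mulrC; congr (_ * _); apply: eq_bigr => b _; rewrite mxE.
Qed.

Lemma contract_last_mul k (A : tensor R n k.+1) v j :
  ((unfold_last A)^T *m v) j 0 = contract_last A v (enum_val j).
Proof. by rewrite mxE; apply: eq_bigr => a _; rewrite !mxE. Qed.

Lemma inner_contract_last k (A : tensor R n k.+1) v :
  inner (contract_last A v) (contract_last A v)
  = dot ((unfold_last A)^T *m v) ((unfold_last A)^T *m v).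
Proof.
rewrite dotE /inner sum_idx_enum.
by apply: eq_bigr => j _; rewrite contract_last_mul.
Qed.

(* The reciprocal of the fraction of the squared norm of an order-m tensor     *)
(* which rank1approx is guaranteed to retain.                                  *)
Fixpoint rank1_loss (m : nat) : R :=
  match m with
  | 0 | 1 => 1
  | 2 => (n 1)%:R
  | (k.+1 as m').+1 => (n m')%:R ^+ 2 * (n m)%:R * rank1_loss k
  end.

Lemma rank1_loss_ge0 m : 0 <= rank1_loss m.
Proof.
(* The recursion descends by two, so two consecutive values are carried. *)
suff: 0 <= rank1_loss m /\ 0 <= rank1_loss m.+1 by case.
elim: m => [|[|m] [IH1 IH2]]; split=> //=.
by rewrite mulr_ge0 // mulr_ge0 ?sqr_ge0 ?ler0n.
Qed.

(** Induction on the run of the procedure. In the recursive case let [s], [t] be the spectral norms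
    of the unfolding and of the reshaped [z], and [p], [q] the last two dimensions. Then
    [|B|^2 <= p q s^2], [1 <= p t^2] and [(s t)^2 <= |C|^2], so [|B|^2 <= p^2 q |C|^2]. *)
Lemma rank1approx_bound m (B : tensor R n m) x :
  rank1approx x B -> inner B B <= rank1_loss m * inner B (outer x) ^+ 2.
Proof.
elim=> {m B} [B xE|B [x1 x2 x1Bx2]|m B y z].
- have B_sum : inner B B = \sum_a B (tt, a) ^+ 2.
    rewrite /inner sum_idxS sum_idx0.
    by apply: eq_bigr => a _; rewrite expr2.
  have -> : inner B (outer x) = inner B B / fnorm B.
    rewrite B_sum /inner sum_idxS sum_idx0 /=.
    by rewrite mulr_suml; apply: eq_bigr => a _; rewrite xE mxE mul1r mulrA expr2.
  (* [B] may vanish; both sides are then 0. *)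
  rewrite mul1r -sqr_fnorm; have [->|B0] := eqVneq (fnorm B) 0.
    by rewrite expr0n mul0r expr0n.
  by rewrite expr2 mulfK.
- have -> : inner B B = mxnorm2 (\matrix_(a, b) B (tt, a, b)).
    rewrite /inner !sum_idxS sum_idx0.
    by apply: eq_bigr => a _; apply: eq_bigr => b _; rewrite mxE expr2.
  have -> : inner B (outer x) = spectral_norm (\matrix_(a, b) B (tt, a, b)).
    rewrite -x1Bx2 !inner_outer_contract; apply: etrans (sum_idx0 _) _.
    rewrite /= mulr1 dotE; apply: eq_bigr => a _; rewrite mxE mulrC.
    by congr (_ * _); apply: eq_bigr => b _; rewrite mxE.
  exact: mxnorm2_le_rows.
move=> lpB [x1 x2 zx] _; set C := contract_last _ _ => IH.
have yB := leading_pair_trmul lpB; case: lpB => /norm2_eq1 y1 /norm2_eq1 z1 _.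
set w := (mxvec (x m.+2 *m (x m.+3)^T))^T.
(* The product equals [s <z, w> = <B^T y, w> = <y, B w>], where [B w] lists the entries of [C];
   Cauchy-Schwarz with [|y| = 1] finishes. *)
have leC : (spectral_norm (unfold_last2 B) * spectral_norm (vec_mx z^T)) ^+ 2
    <= inner C C.
  have -> : inner C C = dot (unfold_last2 B *m w) (unfold_last2 B *m w).
    rewrite dotE /inner sum_idx_enum.
    by apply: eq_bigr => j _; rewrite unfold_last2_mul.
  rewrite -zx -dot_mxvec_outer -dotZv -yB dot_mulmxl trmxK.
  by rewrite (le_trans (dot_sqr_le _ _)) // y1 mul1r.
have leB := mxnorm2_le_cols (unfold_last2 B).
have := mxnorm2_le_rows (vec_mx z^T).
rewrite mxnorm2_vec_mx z1 => leX.
rewrite mxnorm2_unfold_last2 in leB.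
have {IH}leC := le_trans leC IH.
rewrite 2!inner_outer_contract -/C.
apply: le_trans leB _.
set s := spectral_norm (unfold_last2 B) in leC *.
set t := spectral_norm (vec_mx z^T) in leC leX *.
set l := rank1_loss m.+1 in leC *; set c := inner C _ in leC *.
rewrite [rank1_loss _](_ : _ = (n m.+2)%:R ^+ 2 * (n m.+3)%:R * l) // natrM.
set p := (n m.+2)%:R in leX *; set q := (n m.+3)%:R.
have p0 : 0 <= p by apply: ler0n.
have q0 : 0 <= q by apply: ler0n.
(* The inserted factor [p * t ^+ 2] is at least 1 because [z] is a unit vector. *)
apply: (@le_trans _ _ (p * q * s ^+ 2 * (p * t ^+ 2))).
  by rewrite ler_peMr // (mulr_ge0 (mulr_ge0 p0 q0) (sqr_ge0 s)).
by have := ler_wpM2l (mulr_ge0 (sqr_ge0 p) q0) leC; lra.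
Qed.

End Tensor.

(** * The closed form [xi] solves the recursion for the loss *)

Section Xi.
Variables (R : realType) (n : nat -> nat).
Local Notation loss := (rank1_loss R n).

Lemma rank1_lossSS k :
  loss k.+3 = (n k.+2)%:R ^+ 2 * (n k.+3)%:R * loss k.+1.
Proof. by []. Qed.

(** The left side is the radicand of [xi] at [2l+3]. From [l] to [l+1] both sides gain the factors
    [n] at [2l+2], [2l+3] and [2l+4]. *)
Lemma rank1_loss_odd l :
  \prod_(2 <= j < l.*2.+3) (n j)%:R * \prod_(1 <= j < l.+1) (n j.*2)%:R
  = (n l.*2.+2)%:R * loss l.*2.+1.
Proof.
elim: l => [|l IHl]; first by rewrite big_nat1 big_geq.
rewrite !doubleS rank1_lossSS [X in _ * X]big_nat_recr // doubleS.
have -> : \prod_(2 <= j < l.*2.+2.+3) (n j)%:R =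
    \prod_(2 <= j < l.*2.+3) (n j)%:R * (n l.*2.+3)%:R * (n l.*2.+4)%:R :> R.
  by rewrite big_nat_recr // big_nat_recr.
transitivity ((n l.*2.+3)%:R * (n l.*2.+4)%:R * (n l.*2.+2)%:R
  * ((n l.*2.+2)%:R * loss l.*2.+1)); last ring.
rewrite -IHl /=; ring.
Qed.

(** The radicand of [xi] at [2l+4]. The inverse of [n 2] settles the base case: the order-two loss
    is [n 1] alone, while the full product contains [n 2]. *)
Lemma rank1_loss_even l : (0 < n 2)%N ->
  \prod_(1 <= j < l.*2.+4) (n j)%:R * \prod_(1 <= j < l.+1) (n j.*2.+1)%:R
    * (n 2)%:R^-1
  = (n l.*2.+3)%:R * loss l.*2.+2.
Proof.
move=> n2; have n2_neq0 : (n 2)%:R != 0 :> R by rewrite pnatr_eq0 -lt0n.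
elim: l => [|l IHl].
  rewrite /index_iota /= !big_cons !big_nil /=; field; exact: n2_neq0.
rewrite !doubleS rank1_lossSS [X in _ * X * _]big_nat_recr // doubleS.
have -> : \prod_(1 <= j < l.*2.+2.+4) (n j)%:R =
    \prod_(1 <= j < l.*2.+4) (n j)%:R * (n l.*2.+4)%:R * (n l.*2.+4.+1)%:R :> R.
  by rewrite big_nat_recr // big_nat_recr.
transitivity ((n l.*2.+4)%:R * (n l.*2.+3)%:R * (n l.*2.+4.+1)%:R
  * ((n l.*2.+3)%:R * loss l.*2.+2)); last ring.
rewrite -IHl /=; ring.
Qed.

(** Multiplied by [n k.+2] and [n k.+3], the right side becomes the loss at order [k.+3]. *)
Lemma xi_sqr k : (0 < n 2)%N -> xi R n k.+3 ^+ 2 = (n k.+2)%:R * loss k.+1.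
Proof.
move=> n2; rewrite -(odd_double_half k) /xi; set l := k./2.
have loss_ge0 j : 0 <= (n j.+1)%:R * loss j by rewrite mulr_ge0 ?rank1_loss_ge0.
(* [k] and the order [k.+3] have opposite parities. *)
case: (odd k); rewrite ?add1n ?add0n.
  have -> : odd l.*2.+4 = false by rewrite /= negbK odd_double.
  have -> : (l.*2.+4./2 - 2 = l)%N by rewrite -2!doubleS doubleK !subSS subn0.
  by rewrite rank1_loss_even // sqr_sqrtr.
have -> : odd l.*2.+3 by rewrite /= negbK odd_double.
have -> : (l.*2.+4./2 - 2 = l)%N by rewrite -2!doubleS doubleK !subSS subn0.
by rewrite rank1_loss_odd sqr_sqrtr.
Qed.

End Xi.

(** * Bessel's and Ky Fan's inequalities *)

Section KyFan.
Variable R : realType.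

Lemma dot_sumr (I : finType) p (u : 'cV[R]_p) (a : I -> R) (w : I -> 'cV_p) :
  dot u (\sum_i a i *: w i) = \sum_i a i * dot u (w i).
Proof.
by rewrite /dot mulmx_sumr summxE; apply: eq_bigr => i _; apply: dotvZ.
Qed.

(** The residual of [e] after projection on the span has nonnegative squared norm. *)
Lemma bessel r p (w : 'I_r -> 'cV[R]_p) e :
  Defs.orthonormal w -> \sum_i dot e (w i) ^+ 2 <= dot e e.
Proof.
move=> ow; set s := \sum_i dot e (w i) *: w i.
have es : dot e s = \sum_i dot e (w i) ^+ 2.
  by rewrite dot_sumr; apply: eq_bigr => i _; rewrite expr2.
have ss : dot s s = \sum_i dot e (w i) ^+ 2.
  rewrite {2}/s dot_sumr; apply: eq_bigr => i _; rewrite expr2; congr (_ * _).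
  rewrite dotC dot_sumr (bigD1 i) //= big1 ?addr0 ?ow ?eqxx ?mulr1 // => k ki.
  by rewrite ow eq_sym (negPf ki) mulr0.
by have := dotvv_ge0 (e - s); rewrite dotBvv es ss; lra.
Qed.

(** Both weights [c k] and [[k < r]] have total [r], so [s] may be shifted by [s r.-1]; then
    [s k - s r.-1] and [[k < r] - c k] never have opposite signs. *)
Lemma weighted_sum_le (s : nat -> R) p r (c : 'I_p -> R) :
  (0 < r <= p)%N -> (forall i j, (i <= j)%N -> s j <= s i) ->
  (forall k, 0 <= c k <= 1) -> \sum_k c k = r%:R ->
  \sum_(k < p) s k * c k <= \sum_(k < r) s k.
Proof.
move=> /andP[r0 rp] s_dec c01 c_sum.
have -> : \sum_(k < r) s k = \sum_(k < p) s k * (k < r)%:R.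
  rewrite (big_ord_widen _ s rp) big_mkcond /=.
  by apply: eq_bigr => k _; case: ifP => _; rewrite ?mulr1 ?mulr0.
have r_sum : \sum_(k < p) (k < r)%:R = r%:R :> R.
  by rewrite -natr_sum -big_mkcond /= -(big_ord_widen _ (fun=> 1%N) rp)
    sum1_card card_ord.
rewrite -subr_ge0 -sumrB.
have -> : \sum_(k < p) (s k * (k < r)%:R - s k * c k)
    = \sum_(k < p) (s k - s r.-1) * ((k < r)%:R - c k).
  apply/eqP; rewrite -subr_eq0 -sumrB.
  rewrite (eq_bigr (fun k : 'I_p => s r.-1 * ((k < r)%:R - c k))) => [|k _].
    by rewrite -mulr_sumr sumrB c_sum r_sum subrr mulr0.
  ring.
apply: sumr_ge0 => k _; have /andP[c0 c1] := c01 k; case: ltnP => kr.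
  by rewrite mulr_ge0 ?subr_ge0 ?s_dec // -ltnS prednK.
by rewrite mulr_le0 ?subr_le0 ?s_dec // (leq_trans (leq_pred r)).
Qed.

(** With [w i = U^T v i] the sum is a weighted sum of the [s k ^+ 2], of weights
    [c k = \sum_i (w i k 0)^2]. Bessel for the basis vectors gives [c k <= 1], and unit norms give
    total [r]. *)
Lemma ky_fan p q (M : 'M[R]_(p, q)) s r (v : 'I_r -> 'cV_p) :
  (0 < r <= p)%N -> singular_values M s -> Defs.orthonormal v ->
  \sum_i dot (M^T *m v i) (M^T *m v i) <= \sum_(k < r) s k ^+ 2.
Proof.
move=> rp [s_ge0 s_dec s_eq0 [U [V [UU VV ->]]]] ov.
set S := \matrix_(i, j) _.
pose w i := U^T *m v i.
have ow : Defs.orthonormal w.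
  by move=> i k; rewrite dot_mulmxl trmxK mulmxA (mulmx1C UU) mul1mx ov.
have SS : S *m S^T = diag_mx (\row_i s i ^+ 2).
  apply/matrixP => i k; rewrite !mxE; have [iq|qi] := ltnP i q.
    rewrite (bigD1 (Ordinal iq)) //= big1 ?addr0 => [|j ji].
      rewrite !mxE /= eqxx eq_sym mulr1n.
      have [->|ik] := eqVneq i k; first by rewrite eqxx expr2.
      by rewrite -val_eqE in ik; rewrite (negPf ik) mulr0.
    rewrite !mxE; have -> : (i == j :> nat) = false; last by rewrite mul0r.
    by apply/negbTE; rewrite eq_sym; exact: ji.
  (* Row [i] lies below the diagonal block of [S]; the extension of [s] by 0 makes both sides
     vanish. *)
  rewrite s_eq0 ?geq_min ?qi ?orbT // expr0n mul0rn big1 // => j _.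
  by rewrite !mxE s_eq0 ?geq_min ?qi ?orbT // mul0rn mul0r.
have dotM i : dot ((U *m S *m V^T)^T *m v i) ((U *m S *m V^T)^T *m v i)
    = \sum_(k < p) s k ^+ 2 * w i k 0 ^+ 2.
  rewrite !trmx_mul trmxK -mulmxA dot_mulmxl mulmxA VV mul1mx.
  rewrite -mulmxA -/(w i) dot_mulmxl trmxK mulmxA SS dotE.
  move: (w i) => wi.
  by apply: eq_bigr => k _; rewrite mul_diag_mx !mxE mulrCA expr2.
under eq_bigr do rewrite dotM.
rewrite exchange_big /=; under eq_bigr do rewrite -mulr_sumr.
apply: (@weighted_sum_le (fun k => s k ^+ 2)) => // [i j ij|k|].
- rewrite lerXn2r ?nnegrE //.
  by apply: (homo_leq (r := fun x y => y <= x)) ij => // x y z; move/[swap]; apply: le_trans.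
- rewrite sumr_ge0 => [|i _]; last exact: sqr_ge0.
  have := bessel (delta_mx k 0) ow; rewrite dot_delta mxE !eqxx.
  by under eq_bigr do rewrite dot_delta.
rewrite exchange_big /= -[r in RHS]card_ord -sum1_card natr_sum.
by apply: eq_bigr => i _; rewrite -dotvv ow eqxx.
Qed.

End KyFan.

(** * Upper bound for the objective; positivity of the loss *)

Section Objective.
Variables (R : realType) (n : nat -> nat).

(** Cauchy-Schwarz against the unit outer product of the other modes reduces each term to the
    squared norm of [A_(d)^T x_d]. *)
Lemma objective_le d r (A : tensor R n d.+1) s x :
  (0 < r <= n d.+1)%N -> singular_values (unfold_last A) s ->
  feasible d.+1 x -> objective (r := r) A x <= \sum_(i < r) s i ^+ 2.
Proof.
move=> rn sv [x1 ox]; apply: le_trans (ky_fan rn sv ox).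
apply: ler_sum => i _; rewrite inner_outer_contract -inner_contract_last.
apply: le_trans (inner_sqr_le _ _) _; rewrite inner_outer_unit ?mulr1 // => j.
exact: x1.
Qed.

Lemma rank1_loss_gt0 m :
  (forall j, (1 <= j <= m)%N -> (0 < n j)%N) -> 0 < rank1_loss R n m.
Proof.
move=> n_gt0; suff: 0 < rank1_loss R n m /\ 0 < rank1_loss R n m.-1 by case.
elim: m n_gt0 => [|[|[|m]] IHm] n_gt0 //.
  by rewrite /= ltr0n n_gt0 /= ?leqnSn ?leqnn.
have [|IH1 IH2] := IHm; first by move=> j /andP[j1 jm]; rewrite n_gt0 // j1 ltnW.
split=> //; apply: mulr_gt0 => //.
by rewrite mulr_gt0 // ?exprn_gt0 // ltr0n n_gt0 /= ?leqnSn ?leqnn.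
Qed.

End Objective.

(** * Existence of the maximum, by compactness *)

Section Maximum.
Variables (R : realType) (n : nat -> nat) (r : nat).
Local Open Scope classical_set_scope.

Lemma continuous_sum (T : topologicalType) (I : Type) (s : seq I)
    (F : I -> T -> R) :
  (forall i, continuous (F i)) -> continuous (fun t => \sum_(i <- s) F i t).
Proof.
move=> cF; apply: continuous_big => [|i _]; last exact: cF.
exact: add_continuous.
Qed.

(* All entries of all the vectors x_{j,i} are stored in one function, so that  *)
(* Tychonoff's theorem applies to a single product of copies of R.             *)
Definition entries : topologicalType :=
  prod_topology (fun _ : nat * 'I_r * nat => R : topologicalType).

Definition vectors_of (w : entries) (j : nat) (i : 'I_r) : 'cV[R]_(n j) :=
  \col_a w (j, i, val a).

(** The value 0 at irrelevant coordinates keeps the encoding of a feasible family inside the box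
    [[-1, 1]]. *)
Definition entries_of d (x : forall j, 'I_r -> 'cV[R]_(n j)) : entries :=
  fun t => if (1 <= t.1.1 <= d)%N then
    if insub t.2 is Some a then x t.1.1 t.1.2 a 0 else 0 else 0.

Lemma entries_ofK d x j i :
  (1 <= j <= d)%N -> vectors_of (entries_of d x) j i = x j i.
Proof.
by move=> jd; apply/colP => a; rewrite mxE /entries_of /= jd valK.
Qed.

Lemma entry_continuous t : continuous (fun w : entries => w t).
Proof. exact: (@proj_continuous _ (fun=> R : topologicalType) t). Qed.

Lemma dot_vectors_continuous j i k :
  continuous (fun w => dot (vectors_of w j i) (vectors_of w j k)).
Proof.
under eq_fun do rewrite dotE.
apply: continuous_sum => a.
under eq_fun do rewrite !mxE.
by move=> w; apply: continuousM; apply: entry_continuous.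
Qed.

Lemma objective_continuous d (A : tensor R n d) :
  continuous (fun w => objective A (vectors_of w)).
Proof.
have outer_continuous m t i :
    continuous (fun w => outer (m := m) (fun j => vectors_of w j i) t).
  elim: m t => [|m IHm] t.
    exact: (@cst_continuous entries R 1).
  have entry_cont : continuous (fun w => vectors_of w m.+1 i t.2 0).
    by under eq_fun do rewrite mxE; apply: entry_continuous.
  move=> w; exact: (continuousM (IHm t.1 w) (entry_cont w)).
apply: continuous_sum => i w.
have inner_continuous :
    continuous (fun w => inner A (outer (fun j => vectors_of w j i))).
  apply: continuous_sum => t {}w.
  exact: (continuousM (@cst_continuous _ R (A t) w) (outer_continuous d t i w)).
under eq_fun do rewrite expr2.
exact: (continuousM (inner_continuous w) (inner_continuous w)).
Qed.

Lemma closed_equations (T : topologicalType) (I : Type) (D : set I)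
    (f : I -> T -> R) (b : I -> R) :
  (forall i, continuous (f i)) -> closed [set t | forall i, D i -> f i t = b i].
Proof.
move=> cf.
rewrite (_ : [set t | _] = \bigcap_(i in D) f i @^-1` [set y | y = b i]) //.
apply: closed_bigI => i _; exact: preimage_closed.
Qed.

(** A closed set, cut out by equations between inner products, inside a cube compact by Tychonoff.
    The cube also bounds the coordinates that the equations leave free. *)
Lemma feasible_compact d :
  compact [set w : entries | (forall t, `[-1, 1]%classic (w t))
                             /\ feasible d (vectors_of w)].
Proof.
pose sphere := [set w : entries | forall c : nat * 'I_r, (1 <= c.1 < d)%N ->
  dot (vectors_of w c.1 c.2) (vectors_of w c.1 c.2) = 1].
pose frame := [set w : entries | forall c : 'I_r * 'I_r, setT c ->
  dot (vectors_of w d c.1) (vectors_of w d c.2) = (c.1 == c.2)%:R].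
pose box := [set w : entries | forall t, `[-1, 1]%classic (w t)].
have box_compact : compact box.
  apply: (@tychonoff _ (fun=> R : topologicalType) (fun=> `[-1, 1]%classic)) => _.
  exact: segment_compact.
have sphere_closed : closed sphere.
  by apply: closed_equations => c; apply: dot_vectors_continuous.
have frame_closed : closed frame.
  by apply: closed_equations => c; apply: dot_vectors_continuous.
rewrite (_ : [set w | _] = box `&` (sphere `&` frame)).
  by apply: compact_closedI => //; apply: closedI.
apply/seteqP; split=> [w [bw [sw fw]]|w [bw [sw fw]]]; split=> //; split.
- by move=> [j i] jd; apply/norm2_eq1/sw.
- by move=> [i k] _; apply: fw.
- by move=> j i jd; apply/norm2_eq1; apply: (sw (j, i)).
- by move=> i k; apply: (fw (i, k)).
Qed.

Lemma entry_norm_le p (v : 'cV[R]_p) a : norm2 v = 1 -> -1 <= v a 0 <= 1.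
Proof.
move=> v1; have := dot_sqr_le (delta_mx a 0) v.
rewrite -!sqr_norm2 v1 norm2_delta dot_delta => va_le.
by rewrite -ler_norml -(@ler_pXn2r _ 2) ?nnegrE // real_normK ?num_real //; lra.
Qed.

(** Every feasible family has an encoding in the compact set with the same objective, so the maximum
    there is global. The given feasible family makes that set nonempty. *)
Lemma objective_max d (A : tensor R n d) :
  (0 < d)%N -> (exists x : forall j, 'I_r -> 'cV[R]_(n j), feasible d x) ->
  exists g, is_maximum (objective_values r A) g.
Proof.
move=> d_gt0 [x0 fx0].
have feasible_entries x : feasible d x -> 
    [/\ (forall t, `[-1, 1]%classic (entries_of d x t)),
        feasible d (vectors_of (entries_of d x))
      & objective A (vectors_of (entries_of d x)) = objective A x].
  move=> [x1 ox]; split.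
  - move=> [[j i] a]; rewrite /entries_of /= in_itv /=.
    case: ifP => [/andP[j1 jd]|_]; last by rewrite oppr_le0 !ler01.
    case: insub => [b|]; last by rewrite oppr_le0 !ler01.
    (* For mode [d], unit norm is the diagonal case of orthonormality. *)
    apply: entry_norm_le; move: jd; rewrite leq_eqVlt => /predU1P[jd|jd].
      by subst j; apply/norm2_eq1; rewrite ox eqxx.
    by rewrite x1 // j1.
  - split=> [j i jd|i k].
      rewrite entries_ofK; first exact: x1.
      by case/andP: jd => -> /ltnW ->.
    have dd : (1 <= d <= d)%N by rewrite d_gt0 leqnn.
    by rewrite !(entries_ofK _ _ dd) ox.
  - apply: eq_bigr => i _; congr (_ ^+ 2); apply: eq_bigr => t _.
    by congr (_ * _); apply: eq_outer => j jd; rewrite entries_ofK.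
have [x0_box x0_feas _] := feasible_entries _ fx0.
have [w /set_mem[_ fw] w_max] := compact_EVT_max (ex_intro _ _ (conj x0_box x0_feas))
  (@feasible_compact d) (continuous_subspaceT (@objective_continuous d A)).
exists (objective A (vectors_of w)); split; first by exists (vectors_of w).
move=> _ [x /feasible_entries[x_box x_feas <-] <-].
by apply: w_max; apply/mem_set; split.
Qed.

End Maximum.

(** * The two inequalities for the initialization *)

Theorem proposition3p2 (R : realType) (d : nat) (n : nat -> nat)
    (A : tensor R n d) (r : nat) (lambda : nat -> R)
    (u : forall j : nat, 'I_r -> 'cV[R]_(n j)) :
  (4 <= d)%N ->
  (forall j : nat, (1 <= j <= d)%N -> (0 < n j)%N) ->
  (0 < r <= n d)%N ->
  singular_values (unfold_last A) lambda ->
  0 < lambda r.-1 ->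
  initialization A lambda u ->
  \sum_(i < r) inner A (outer (fun j => u j i)) ^+ 2
    >= (\sum_(i < r) lambda i ^+ 2)
       / (xi R n d.-1 ^+ 2 * (n d.-2)%:R * (n d.-1)%:R)
  /\ exists2 Gmax : R, is_maximum (objective_values r A) Gmax
     & (\sum_(i < r) lambda i ^+ 2)
       / (xi R n d.-1 ^+ 2 * (n d.-2)%:R * (n d.-1)%:R)
       >= Gmax / (xi R n d.-1 ^+ 2 * (n d.-2)%:R * (n d.-1)%:R).
Proof.
case: d A => [|[|[|[|k]]]] // A _ n_gt0 rn sv _ [ou lsv r1].
(* Here [d = k.+4]: the common denominator is the loss at order [d - 1]. *)
have lossE : xi R n k.+3 ^+ 2 * (n k.+2)%:R * (n k.+3)%:R = rank1_loss R n k.+3.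
  rewrite xi_sqr ?n_gt0 // rank1_lossSS; ring.
rewrite lossE.
have loss_gt0 : 0 < rank1_loss R n k.+3.
  by apply: rank1_loss_gt0 => j /andP[j1 jk]; rewrite n_gt0 // j1 ltnW.
split.
  rewrite ler_pdivrMr // mulr_suml; apply: ler_sum => i _.
  rewrite inner_outer_contract mulrC; apply: le_trans (rank1approx_bound (r1 i)).
  (* The contraction of [A] with [u d i] is [lambda i] times a unit vector, so its squared norm is
     [lambda i ^+ 2]. *)
  have [/norm2_eq1 u1 [v [/norm2_eq1 v1 _ Mu]]] := lsv i.
  by rewrite inner_contract_last Mu dotvZ dotZv v1 mulr1 expr2.
have [||g g_max] := @objective_max _ _ r _ A => //.
  (* A feasible family: the given orthonormal vectors in mode [d], and the first basis vector,
     available as [0 < n j], in each earlier mode. *)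
  exists (fun j i => if j == k.+4 then u j i else \col_a (a == 0 :> nat)%:R).
  split=> [j i /andP[j1 jk]|]; last by rewrite eqxx.
  rewrite ltn_eqF //.
  have nj : (0 < n j)%N by rewrite n_gt0 // j1 ltnW.
  rewrite -[RHS](norm2_delta R (Ordinal nj)); congr norm2.
  by apply/colP => a; rewrite !mxE eqxx andbT.
exists g => //; rewrite ler_pM2r ?invr_gt0 //.
by have [[x fx <-] _] := g_max; apply: objective_le.
Qed.
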